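(* Suppose that a complex-valued sequence $(a_n)$ satisfies both $$a_n \sim \sum_{\omega \in \Omega} h_{\omega}(n) \sum_{\lambda \in \Lambda} c_{\omega,\lambda} \lambda^n \qquad\text{and}\qquad a_n \sim \sum_{\omega' \in \Omega'} h_{\omega'}(n) \sum_{\lambda' \in \Lambda'} c'_{\omega',\lambda'} (\lambda')^n ,$$ where the first asymptotic expansion is $\Omega\times\Lambda$-minimal and the second one is $\Omega'\times\Lambda'$-minimal. Then $\Omega=\Omega'$ and $\Lambda=\Lambda'$. Moreover, $c_{\omega,\lambda}=c'_{\omega,\lambda}$ for all $(\omega,\lambda)\in\Omega\times\Lambda$.
   Context: $\mathbb N=\{0,1,2,\dots\}$. All limits and $o(1)$ are taken as $n\to\infty$. Full index sets. For $d\in\mathbb N$ and a finite set $S\subset\mathbb Q$, let $\widetilde\Omega=(S+\mathbb N)\times\{0,1,\dots,d\}$, where $S+\mathbb N=\{s+m: s\in S, m\in\mathbb N\}$, ordered by: $(\alpha,\beta)<(\alpha',\beta')$ if and only if $\alpha<\alpha'$, or $\alpha=\alpha'$ and $\beta'<\beta$. Any ordered set $\widetilde\Omega$ of this form is called a full index set. For every $\omega\in\widetilde\Omega$ the set of elements smaller than $\omega$ is finite. For $\omega=(\alpha,\beta)$ put $h_\omega(n)=\dfrac{(\log n)^\beta}{n^\alpha}$. Asymptotic expansion over a full index set. Let $\widetilde\Omega=(S+\mathbb N)\times\{0,1,\dots,d\}$ be a full index set (for some $d\in\mathbb N$ and some finite set $S\subset\mathbb Q$), let $\Lambda$ be a finite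 set of nonzero complex numbers all of the same magnitude $r>0$, and let $c_{\omega,\lambda}\in\mathbb C$ for $(\omega,\lambda)\in\widetilde\Omega\times\Lambda$. The expression $a_n\sim\sum_{\omega\in\widetilde\Omega}h_\omega(n)\sum_{\lambda\in\Lambda}c_{\omega,\lambda}\lambda^n$ means that (i) for every $\omega\in\widetilde\Omega$, $$\Big(a_n r^{-n}-\sum_{\omega'\in\widetilde\Omega,\ \omega'\le\omega}h_{\omega'}(n)\sum_{\lambda\in\Lambda}c_{\omega',\lambda}(\lambda r^{-1})^n\Big)\frac1{h_\omega(n)}=o(1),$$ and (ii) $c_{\omega,\lambda}\ne0$ for some $(\omega,\lambda)\in\widetilde\Omega\times\Lambda$. Subsets of index sets. For a subset $\Omega\subset\widetilde\Omega$ of a full index set and complex numbers $c_{\omega,\lambda}$, $(\omega,\lambda)\in\Omega\times\Lambda$, the expression $a_n\sim\sum_{\omega\in\Omega}h_\omega(n)\sum_{\lambda\in\Lambda}c_{\omega,\lambda}\lambda^n$ means that, for some full index set $\widetilde\Omega\supset\Omega$, the expansion $a_n\sim\sum_{\omega\in\widetilde\Omega}h_\omega(n)\sum_{\lambda\in\Lambda}c_{\omega,\lambda}\lambda^n$ holds (that is, conditions (i) and (ii) are satisfied for $\widetilde\Omega$) when one sets $c_{\omega,\lambda}=0$ for $\omega\in\widetilde\Omega\setminus\Omega$ and $\lambda\in\Lambda$. Minimality. The expansion is $\Omega\times\Lambda$-minimal if for every $\lambda\in\Lambda$ there exists $\omega\in\Omega$ with $c_{\omega,\lambda}\neq0$,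 and for every $\omega\in\Omega$ there exists $\lambda\in\Lambda$ with $c_{\omega,\lambda}\ne0$. In the claim, $\Omega$ and $\Omega'$ are subsets of (possibly different) full index sets, and $\Lambda$, $\Lambda'$ are finite sets of nonzero complex numbers, the elements of each having equal magnitude (the magnitudes of the two sets are not assumed equal a priori). *)

(* Defs.v *)
From mathcomp Require Import all_boot all_order all_algebra.
From mathcomp Require Import finmap.
From mathcomp Require Import all_classical all_reals all_analysis.
From mathcomp Require Import complex.
Set Implicit Arguments.
Unset Strict Implicit.
Unset Printing Implicit Defensive.
Import Order.TTheory GRing.Theory Num.Theory.
Import numFieldNormedType.Exports.
Local Open Scope classical_set_scope.
Local Open Scope ring_scope.
Local Open Scope complex_scope.

(* An index omega = (alpha, beta) is an element of rat * nat. *)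
Definition hindex : Type := (rat * nat)%type.

Definition full_index_set (S : {fset rat}) (d : nat) : set hindex :=
  [set w : hindex | (exists2 s, s \in S & exists m : nat, w.1 = s + m%:R)
                   /\ (w.2 <= d)%N].

(* For equal alpha, the larger exponent of the logarithm comes first. *)
Definition index_lt (w w' : hindex) : bool :=
  (w.1 < w'.1) || (w.1 == w'.1) && (w'.2 < w.2)%N.

Definition index_le (w w' : hindex) : bool := (w == w') || index_lt w w'.

Definition initial_segment (S : {fset rat}) (d : nat) (w : hindex) : set hindex :=
  [set w' | full_index_set S d w' /\ index_le w' w].

(* The sums over initial segments below use \sum_(_ \in _), which is 0 by
   convention on infinite supports; this lemma rules that case out. *)
Lemma finite_initial_segment (S : {fset rat}) (d : nat) (w : hindex) :
  finite_set (initial_segment S d w).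
Proof.
pose N s := Num.bound (w.1 - s).
pose L := flatten [seq flatten [seq [seq ((s + m%:R, b) : hindex) |
            b <- iota 0 d.+1] | m <- iota 0 (N s).+1] | s <- enum_fset S].
apply: (@sub_finite_set _ _ [set` L]); last exact: finite_seq.
move=> [x b] [[[s sS [m /= ->]] /= bd] le]; rewrite /= /L.
apply/flatten_mapP; exists s => //.
apply/flatten_mapP; exists m; last first.
  by apply/mapP; exists b => //; rewrite mem_iota add0n ltnS.
rewrite mem_iota add0n leq0n /= ltnS.
have {}le : s + m%:R <= w.1.
  case/orP: le => [/eqP <-//|]; rewrite /index_lt /=.
  by case/orP => [/ltW//|/andP[/eqP-> _]].
have h : m%:R <= w.1 - s by rewrite lerBrDl.
have h0 : 0 <= w.1 - s by apply: le_trans h.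
rewrite -(ler_nat rat); apply: (le_trans h); apply: ltW.
by apply: le_lt_trans (archi_boundP h0).
Qed.

Section Expansions.
Variable R : realType.
Implicit Types (a : nat -> R[i]) (Lam : {fset R[i]}) (c : hindex -> R[i] -> R[i]).

Definition hfun (w : hindex) (n : nat) : R :=
  ln n%:R ^+ w.2 / n%:R `^ ratr w.1.

Definition common_magnitude Lam (r : R) : Prop :=
  0 < r /\ (forall l, l \in Lam -> `|l| = r%:C).

Definition remainder a S d Lam r c (w : hindex) (n : nat) : R[i] :=
  a n * r%:C ^- n -
  \sum_(w' \in initial_segment S d w)
     (hfun w' n)%:C * \sum_(l <- Lam) c w' l * (l * r%:C^-1) ^+ n.

(* R[i]^o carries the topology of the modulus. *)
Definition full_expansion a S d Lam r c : Prop :=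
  (forall w, full_index_set S d w ->
     (fun n => remainder a S d Lam r c w n * ((hfun w n)%:C)^-1) @ \oo
       --> (0 : R[i]^o))
  /\ (exists w l, [/\ full_index_set S d w, l \in Lam & c w l != 0]).

Definition extend0 (Omega : set hindex) c : hindex -> R[i] -> R[i] :=
  fun w l => if w \in Omega then c w l else 0.

(* Only the values of c on Omega * Lam are used. *)
Definition asymp_expansion a (Omega : set hindex) Lam c : Prop :=
  exists (S : {fset rat}) (d : nat) (r : R),
    [/\ Omega `<=` full_index_set S d,
        common_magnitude Lam r
      & full_expansion a S d Lam r (extend0 Omega c)].

Definition minimal_expansion (Omega : set hindex) Lam c : Prop :=
  (forall l, l \in Lam -> exists2 w, Omega w & c w l != 0) /\
  (forall w, Omega w -> exists2 l, l \in Lam & c w l != 0).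

End Expansions.

(* Main.v *)
Require Import Defs.
From mathcomp Require Import all_boot all_order all_algebra.
From mathcomp Require Import finmap.
From mathcomp Require Import all_classical all_reals all_analysis.
From mathcomp Require Import complex.
From mathcomp Require Import ring.
Set Implicit Arguments.
Unset Strict Implicit.
Unset Printing Implicit Defensive.
Import Order.TTheory GRing.Theory Num.Theory.
Import numFieldNormedType.Exports.
Local Open Scope classical_set_scope.
Local Open Scope ring_scope.
Local Open Scope complex_scope.

(** An expansion determines its coefficients, provided that they are regarded
    as one function [total_coef] of the pair (index, base), extended by 0
    outside [Omega * Lam]; minimality then says that [Omega] and [Lam] are the
    two projections of the support of this function, so equality of the
    functions ([asymp_expansion_coef_unique]) gives the theorem.

    To compare two expansions they are brought into a common frame.  The
    conditions of an expansion over one full index set imply the same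
    conditions over every larger full index set, at every index whatsoever and
    over every larger set of bases ([asymp_expansion_expands]): the remainder
    at [w] differs from the remainder at a later index [u] of the smaller set
    by finitely many terms, all of lower order than [w].  This rests on
    [h_v / h_w -> 0] for [w < v] ([hfun_ratio_cvg0]).

    If both sets of bases have the same magnitude, the two expansions can now
    be subtracted, and an expansion of 0 has zero coefficients
    ([expands_eq0]): going up the indices, the first remaining term [w] yields
    [sum_l c_(w,l) (l/r)^n -> 0], and a linear combination of powers of distinct
    numbers of modulus 1 tends to 0 only if it is trivial
    ([vanishing_exp_sum]).

    If the magnitudes were [r < r'], then [a_n r'^-n = (a_n r^-n) (r/r')^n]
    would decay faster than every [h_w] ([expands_geometric]), because
    geometric decay beats powers of [n] and of [log n].  Again by [expands_eq0]
    the second expansion would have only zero coefficients, which condition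
    (ii) excludes ([expands_magnitude_le]). *)

(** * Comparison of the scale functions *)

(** One more power of [s * u] than needed is extracted from the exponential
    series, which leaves a multiple of [1 / u].  With [u n = log n] this compares
    two powers of [n], with [u n = n] it compares a power of [n] with a
    geometric sequence. *)
Lemma cvg_exprn_expRN (R : realType) (u : nat -> R) (k : nat) (s : R) :
  0 < s -> u @ \oo --> +oo ->
  (fun n => u n ^+ k * expR (- (s * u n))) @ \oo --> (0 : R).
Proof.
move=> s0 uy.
have u0 : \forall n \near \oo, 0 < u n by move/cvgryPgt: uy; apply.
pose K : R := k.+1`!%:R / s ^+ k.+1.
apply: (@squeeze_cvgr _ _ _ _ (fun=> 0) (fun n => K * (u n)^-1)).
- near=> n.
  have un0 : 0 < u n by near: n.
  rewrite mulr_ge0 ?exprn_ge0 ?expR_ge0 ?(ltW un0)//=.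
  rewrite expRN ler_pdivrMr ?expR_gt0//.
  have := expR_ge1Dxn k (ltW (mulr_gt0 s0 un0)).
  move=> /(le_trans _) -/(_ ((s * u n) ^+ k.+1 / (k.+1)`!%:R)).
  rewrite lerDr ler01 => /(_ isT) le_exp.
  have K0 : 0 < K * (u n)^-1.
    by rewrite mulr_gt0 ?invr_gt0// divr_gt0 ?exprn_gt0// ltr0n fact_gt0.
  apply: le_trans (ler_wpM2l (ltW K0) le_exp).
  rewrite le_eqVlt; apply/orP; left; apply/eqP.
  rewrite /K exprMn (exprSr (u n)); field.
  by rewrite !lt0r_neq0 ?exprn_gt0 ?ltr0n ?fact_gt0.
- exact: cvg_cst.
- rewrite -[0](mulr0 K); apply: cvgM; first exact: cvg_cst.
  exact: (gtr0_cvgV0 u0).2 uy.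
Unshelve. all: by end_near. Qed.

Lemma cvg_lnn (R : realType) : (fun n => ln n%:R : R) @ \oo --> +oo.
Proof.
apply/cvgryPge => A; near=> n.
have le_n : expR A <= n%:R.
  by near: n; move/cvgryPge: (@cvgr_idn R); apply.
by rewrite -[A]expRK ler_ln ?posrE ?expR_gt0// (lt_le_trans (expR_gt0 A)).
Unshelve. all: by end_near. Qed.

Lemma lnn_ge1 (R : realType) : \forall n \near \oo, 1 <= ln n%:R :> R.
Proof. by move/cvgryPge: (@cvg_lnn R); apply. Qed.

Lemma hfun_gt0 (R : realType) (w : hindex) :
  \forall n \near \oo, 0 < hfun R w n.
Proof.
near=> n; have l1 : 1 <= ln n%:R :> R by near: n; exact: lnn_ge1.
rewrite /hfun divr_gt0 ?exprn_gt0 ?(lt_le_trans ltr01 l1)// powR_gt0// ltr0n.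
by near: n; exists 1%N.
Unshelve. all: by end_near. Qed.

(** Every scale ratio becomes a power of [log n] times an exponential of
    [log n], the form to which [cvg_exprn_expRN] applies. *)
Lemma hfun_ratioE (R : realType) (v w : hindex) : \forall n \near \oo,
  hfun R v n / hfun R w n =
  ln n%:R ^+ v.2 * expR (- ((ratr v.1 - ratr w.1) * ln n%:R)) / ln n%:R ^+ w.2.
Proof.
near=> n.
have l1 : 1 <= ln n%:R :> R by near: n; exact: lnn_ge1.
have l0 : 0 < ln n%:R :> R by exact: lt_le_trans l1.
have n0 : (0 < n)%N by near: n; exists 1%N.
have n0R : n%:R != 0 :> R by rewrite pnatr_eq0 -lt0n.
rewrite /hfun /powR (negbTE n0R) mulrBl opprB expRD expRN.
by field; rewrite !lt0r_neq0 ?exprn_gt0 ?expR_gt0.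
Unshelve. all: by end_near. Qed.

Lemma hfun_ratio_le (R : realType) (v w : hindex) : \forall n \near \oo,
  0 <= hfun R v n / hfun R w n <=
  ln n%:R ^+ v.2 * expR (- ((ratr v.1 - ratr w.1) * ln n%:R)).
Proof.
near=> n.
have l1 : 1 <= ln n%:R :> R by near: n; exact: lnn_ge1.
have l0 : 0 < ln n%:R :> R by exact: lt_le_trans l1.
have hw : 0 < hfun R w n by near: n; exact: hfun_gt0.
have hv : 0 < hfun R v n by near: n; exact: hfun_gt0.
rewrite (ltW (divr_gt0 hv hw))/=.
have -> : hfun R v n / hfun R w n = ln n%:R ^+ v.2 *
    expR (- ((ratr v.1 - ratr w.1) * ln n%:R)) / ln n%:R ^+ w.2.
  by near: n; exact: hfun_ratioE.
by rewrite ler_piMr ?mulr_ge0 ?exprn_ge0 ?expR_ge0 ?(ltW l0)//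
   invf_le1 ?exprn_gt0// exprn_ege1.
Unshelve. all: by end_near. Qed.

Lemma hfun_ratio_cvg0 (R : realType) (v w : hindex) : index_lt w v ->
  (fun n => hfun R v n / hfun R w n) @ \oo --> (0 : R).
Proof.
rewrite /index_lt => /orP[lt1|/andP[/eqP eq1 lt2]].
- have s0 : 0 < ratr v.1 - ratr w.1 :> R by rewrite subr_gt0 ltr_rat.
  apply: (squeeze_cvgr _ (cvg_cst 0) (cvg_exprn_expRN v.2 s0 (@cvg_lnn R))).
  exact: hfun_ratio_le.
- have inv0 : (fun n => (ln n%:R : R)^-1) @ \oo --> (0 : R).
    apply: (gtr0_cvgV0 _).2 (@cvg_lnn R).
    by near=> n; apply: (lt_le_trans ltr01); near: n; exact: lnn_ge1.
  apply: (squeeze_cvgr _ (cvg_cst 0) inv0).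
  near=> n.
  have l1 : 1 <= ln n%:R :> R by near: n; exact: lnn_ge1.
  have l0 : 0 < ln n%:R :> R by exact: lt_le_trans l1.
  have hw : 0 < hfun R w n by near: n; exact: hfun_gt0.
  have hv : 0 < hfun R v n by near: n; exact: hfun_gt0.
  rewrite (ltW (divr_gt0 hv hw))/=.
  have -> : hfun R v n / hfun R w n = ln n%:R ^+ v.2 *
      expR (- ((ratr v.1 - ratr w.1) * ln n%:R)) / ln n%:R ^+ w.2.
    by near: n; exact: hfun_ratioE.
  rewrite eq1 subrr mul0r oppr0 expR0 mulr1 ler_pdivrMr ?exprn_gt0//.
  rewrite -(subnKC lt2) addSn exprS mulKf ?lt0r_neq0// exprD.
  by rewrite ler_peMr ?exprn_ge0 ?(ltW l0)// exprn_ege1.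
Unshelve. all: by end_near. Qed.

Lemma hfun_ratio_geometric_cvg0 (R : realType) (v w : hindex) (q : R) :
  0 < q < 1 ->
  (fun n => hfun R v n / hfun R w n * q ^+ n) @ \oo --> (0 : R).
Proof.
move=> /andP[q0 q1].
have s0 : 0 < - ln q by rewrite oppr_gt0 ln_lt0// q0 q1.
(* n ^ m dominates n `^ (w.1 - v.1), and n dominates ln n. *)
pose m := Num.bound `|ratr w.1 - ratr v.1 : R|.
apply: (squeeze_cvgr _ (cvg_cst 0)
  (cvg_exprn_expRN (v.2 + m) s0 (@cvgr_idn R))).
near=> n.
have l1 : 1 <= ln n%:R :> R by near: n; exact: lnn_ge1.
have l0 : 0 < ln n%:R :> R by exact: lt_le_trans l1.
have n0 : 0 < n%:R :> R by rewrite ltr0n; near: n; exists 1%N.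
have /andP[ratio_ge0 ratio_le] : 0 <= hfun R v n / hfun R w n <=
    ln n%:R ^+ v.2 * expR (- ((ratr v.1 - ratr w.1) * ln n%:R)).
  by near: n; exact: hfun_ratio_le.
rewrite (mulr_ge0 ratio_ge0 (exprn_ge0 _ (ltW q0)))/=.
have -> : expR (- (- ln q * n%:R)) = q ^+ n.
  by rewrite mulNr opprK mulrC expRM_natl lnK.
rewrite ler_wpM2r ?exprn_ge0 ?(ltW q0)//; apply: le_trans ratio_le _.
rewrite exprD; apply: ler_pM; [by rewrite exprn_ge0// ltW|exact: expR_ge0| |].
  apply: lerXn2r; [by rewrite nnegrE ltW|by rewrite nnegrE ltW|].
  exact/ltW/ln_sublinear.
have -> : n%:R ^+ m = expR (m%:R * ln n%:R) :> R by rewrite expRM_natl lnK.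
rewrite ler_expR -mulNr opprB ler_pM2r//.
by rewrite (le_trans (ler_norm _))// ltW// archi_boundP.
Unshelve. all: by end_near. Qed.

(** * Null sequences of complex numbers *)

Definition vanishing (R : realType) (f : nat -> R[i]) : Prop :=
  f @ \oo --> (0 : R[i]^o).

Lemma vanishingP (R : realType) (f : nat -> R[i]) : vanishing f <->
  forall e : R, 0 < e -> \forall n \near \oo, `|f n| < e%:C.
Proof.
split=> [f0 e e0|f0].
  by apply: (@cvgr0_norm_lt _ (R[i]^o) _ _ _ f f0 e%:C); rewrite ltcR.
apply: (@cvgr0Pnorm_lt _ (R[i]^o) _ _ _ f).2 => e e0.
have e_real : e = (complex.Re e)%:C by rewrite RRe_real// ger0_real// ltW.
by rewrite e_real; apply: f0; rewrite -ltcR -e_real.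
Qed.

Lemma vanishing_near (R : realType) (f g : nat -> R[i]) :
  (\forall n \near \oo, f n = g n) -> vanishing f -> vanishing g.
Proof.
move=> fg /vanishingP f0; apply/vanishingP => e e0.
near=> n; have <- : f n = g n by near: n.
by near: n; exact: f0.
Unshelve. all: by end_near. Qed.

Lemma vanishing0 (R : realType) : vanishing (fun=> 0 : R[i]).
Proof.
by apply/vanishingP => e e0; near=> n; rewrite normr0 ltcR.
Unshelve. all: by end_near. Qed.

Lemma vanishingD (R : realType) (f g : nat -> R[i]) :
  vanishing f -> vanishing g -> vanishing (fun n => f n + g n).
Proof.
move=> /vanishingP f0 /vanishingP g0; apply/vanishingP => e e0.
have e2 : 0 < e / 2 by rewrite divr_gt0.
near=> n; rewrite (splitr e) rmorphD/= (le_lt_trans (ler_normD _ _))//.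
by rewrite ltrD//; near: n; [exact: f0|exact: g0].
Unshelve. all: by end_near. Qed.

Lemma vanishing_sum (R : realType) (I : eqType) (s : seq I)
    (f : I -> nat -> R[i]) :
  (forall i, i \in s -> vanishing (f i)) ->
  vanishing (fun n => \sum_(i <- s) f i n).
Proof.
elim: s => [|i s IHs] fs0.
  by under eq_fun do rewrite big_nil; exact: vanishing0.
under eq_fun do rewrite big_cons.
apply: vanishingD; first by apply: fs0; rewrite mem_head.
by apply: IHs => j js; apply: fs0; rewrite in_cons js orbT.
Qed.

Lemma vanishing_bounded (R : realType) (f g : nat -> R[i]) (M : R) :
  (forall n, `|g n| <= M%:C) -> vanishing f -> vanishing (fun n => f n * g n).
Proof.
move=> gM /vanishingP f0; apply/vanishingP => e e0.
have M0 : 0 <= M by rewrite -ler0c (le_trans _ (gM 0%N)).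
have M1 : 0 < M + 1 by rewrite ltr_wpDl.
near=> n.
have lt_f : `|f n| < (e / (M + 1))%:C.
  by near: n; apply: f0; rewrite divr_gt0.
rewrite normrM (@le_lt_trans _ _ (`|f n| * (M + 1)%:C))//.
  by rewrite ler_wpM2l// (le_trans (gM n))// lecR lerDl.
rewrite (@lt_le_trans _ _ ((e / (M + 1))%:C * (M + 1)%:C))//.
  by rewrite ltr_pM2r// ltcR.
by rewrite -rmorphM/= divfK ?lt0r_neq0.
Unshelve. all: by end_near. Qed.

Lemma vanishingN (R : realType) (f : nat -> R[i]) :
  vanishing f -> vanishing (fun n => - f n).
Proof.
move=> /vanishingP f0; apply/vanishingP => e /f0.
by apply: filterS => n; rewrite normrN.
Qed.

Lemma vanishing_real (R : realType) (u : nat -> R) :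
  u @ \oo --> (0 : R) -> vanishing (fun n => (u n)%:C).
Proof.
move=> u0; apply/vanishingP => e e0.
near=> n; rewrite normc_def/= expr0n addr0 sqrtr_sqr ltcR.
by near: n; exact: cvgr0_norm_lt.
Unshelve. all: by end_near. Qed.

(** By induction on [s]: if [f] is the given sum, then [f (n + 1) - m f n] also
    tends to 0 and is a sum over [s] without the base [m], with coefficients
    [c z (z - m)].  Once all the other coefficients are known to be 0, [f n]
    equals [c m m^n], of constant modulus [|c m|]. *)
Lemma vanishing_exp_sum (R : realType) (s : seq R[i]) (c : R[i] -> R[i]) :
  uniq s -> (forall z, z \in s -> `|z| = 1) ->
  vanishing (fun n => \sum_(z <- s) c z * z ^+ n) ->
  forall z, z \in s -> c z = 0.
Proof.
elim: s c => [//|m s IHs] c /= /andP[ms us] s1 sum0.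
have c_s z : z \in s -> c z = 0.
  move=> zs; have zm : z - m != 0.
    by rewrite subr_eq0; apply: contraNneq ms => <-.
  apply: (mulIf zm); rewrite mul0r.
  apply: (IHs (fun z => c z * (z - m))) => // {z zs zm}.
    by move=> z zs; apply: s1; rewrite in_cons zs orbT.
  have shift0 : vanishing (fun n => \sum_(z <- m :: s) c z * z ^+ n.+1).
    move: sum0 => /vanishingP sum0; apply/vanishingP => e e0.
    have [N _ sN] := sum0 _ e0.
    by exists N => // n /= Nn; apply: sN; exact: leqW.
  have m1 (n : nat) : `|m| <= 1%:C by rewrite s1 ?mem_head.
  have := vanishingD shift0 (vanishingN (vanishing_bounded m1 sum0)).
  apply: vanishing_near; near=> n.
  rewrite big_distrl/= -sumrB big_cons -mulrA -exprSr subrr add0r.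
  by apply: eq_bigr => z _; rewrite exprS; ring.
move=> z; rewrite in_cons => /orP[/eqP->|]; last exact: c_s.
apply/eqP; apply: contraT => cm0.
have cm : `|c m| = (complex.Re `|c m|)%:C by rewrite RRe_real.
have /vanishingP/(_ (complex.Re `|c m|)) := sum0.
rewrite -ltcR -cm normr_gt0 => /(_ cm0) [N _ /(_ N)] /= /(_ (leqnn _)).
rewrite big_cons big_seq big1 => [|x xs]; last by rewrite c_s ?mul0r.
by rewrite addr0 normrM normrX (s1 m) ?mem_head// expr1n mulr1 ltxx.
Unshelve. all: by end_near. Qed.

(** * The order on indices *)

Lemma index_ltNge (v w : hindex) : index_lt w v = ~~ index_le v w.
Proof.
case: v w => [a b] [a' b']; rewrite /index_le /index_lt /= xpair_eqE.
by case: (ltgtP a a') => //= _; case: (ltngtP b b').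
Qed.

Lemma index_lt_trans (v u w : hindex) :
  index_lt u v -> index_lt v w -> index_lt u w.
Proof.
case: u v w => [a b] [a' b'] [a'' b'']; rewrite /index_lt /=.
move=> /orP[aa'|/andP[/eqP<- bb']] /orP[a'a''|/andP[/eqP<- b'b'']].
- by rewrite (lt_trans aa').
- by rewrite aa'.
- by rewrite a'a''.
- by rewrite eqxx (ltn_trans b'b'') ?orbT.
Qed.

Lemma index_le_lt_trans (v u w : hindex) :
  index_le u v -> index_lt v w -> index_lt u w.
Proof. by move=> /orP[/eqP->//|]; exact: index_lt_trans. Qed.

Lemma full_index_set_sub (S T : {fset rat}) (d e : nat) :
  (S `<=` T)%fset -> (d <= e)%N ->
  full_index_set S d `<=` full_index_set T e.
Proof.
move=> ST de v [[s sS sv] vd]; split; last exact: leq_trans de.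
by exists s => //; exact: (fsubsetP ST).
Qed.

Lemma exists_index_gt (S : {fset rat}) (d : nat) (w0 w : hindex) :
  full_index_set S d w0 -> exists2 u, full_index_set S d u & index_lt w u.
Proof.
move=> [[s sS _] _]; pose m := Num.bound `|w.1 - s|.
exists (s + m%:R, 0%N); first by split=> //=; exists s => //; exists m.
rewrite /index_lt/= -ltrBlDl; apply/orP; left.
by rewrite (le_lt_trans (ler_norm _))// archi_boundP.
Qed.

(** * Expansions at all indices *)

(** The factor of [hfun w] in the expansion after division by [r ^+ n]: a
    combination of powers of numbers that have modulus 1, hence bounded, when
    all of [L] has magnitude [r]. *)
Definition amplitude (R : realType) (L : {fset R[i]}) (r : R)
    (D : hindex -> R[i] -> R[i]) (w : hindex) (n : nat) : R[i] :=
  \sum_(l <- L) D w l * (l * r%:C^-1) ^+ n.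

(** Unlike condition (i), the remainder is tested at every index [w], including
    those outside the full index set.  This makes the notion stable under
    enlarging [T], [e] and [L] as long as the new coefficients are 0. *)
Definition expands (R : realType) (b : nat -> R[i]) (T : {fset rat}) (e : nat)
    (L : {fset R[i]}) (r : R) (D : hindex -> R[i] -> R[i]) : Prop :=
  forall w, vanishing (fun n => (b n -
    \sum_(v \in initial_segment T e w) (hfun R v n)%:C * amplitude L r D v n)
      / (hfun R w n)%:C).

Lemma norm_div_magnitude (R : realType) (L : {fset R[i]}) (r : R) (l : R[i]) :
  common_magnitude L r -> l \in L -> `|l * r%:C^-1| = 1.
Proof.
move=> [r0 Lr] lL; rewrite normrM normfV Lr// gtr0_norm ?ltcR// divff//.
by rewrite lt0r_neq0// ltcR.
Qed.

Lemma amplitude_bounded (R : realType) (L : {fset R[i]}) (r : R)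
    (D : hindex -> R[i] -> R[i]) (w : hindex) : common_magnitude L r ->
  exists M : R, forall n, `|amplitude L r D w n| <= M%:C.
Proof.
move=> Lr; pose M := \sum_(l <- L) `|D w l|.
exists (complex.Re M) => n.
rewrite RRe_real ?ger0_real ?sumr_ge0//.
rewrite (le_trans (ler_norm_sum _ _ _))// /M !big_seq ler_sum// => l lL.
by rewrite normrM normrX (norm_div_magnitude Lr)// expr1n mulr1.
Qed.

Lemma vanishing_amplitude (R : realType) (L : {fset R[i]}) (r : R)
    (D : hindex -> R[i] -> R[i]) (w : hindex) : common_magnitude L r ->
  vanishing (amplitude L r D w) -> forall l, l \in L -> D w l = 0.
Proof.
move=> Lr amp0 l lL.
have r0 : r%:C != 0 by case: Lr => r0 _; rewrite lt0r_neq0// ltcR.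
have div_inj : injective (fun x : R[i] => x * r%:C^-1).
  by apply: mulIf; rewrite invr_eq0.
have := @vanishing_exp_sum _ [seq x * r%:C^-1 | x <- L]
  (fun z => D w (z * r%:C)) _ _ _ (l * r%:C^-1).
rewrite divfK//; apply.
- by rewrite map_inj_uniq ?fset_uniq.
- by move=> z /mapP[x xL ->]; exact: (norm_div_magnitude Lr).
- apply: vanishing_near amp0; near=> n.
  by rewrite big_map; apply: eq_bigr => x _; rewrite divfK.
- by apply/mapP; exists l.
Unshelve. all: by end_near. Qed.

Lemma amplitude_widen (R : realType) (L L' : {fset R[i]}) (r : R)
    (D : hindex -> R[i] -> R[i]) (w : hindex) (n : nat) : (L `<=` L')%fset ->
  (forall l, l \notin L -> D w l = 0) ->
  amplitude L r D w n = amplitude L' r D w n.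
Proof.
move=> LL' D0; apply: big_fset_incl => // l _ /D0 ->.
by rewrite mul0r.
Qed.

Lemma amplitude0 (R : realType) (L : {fset R[i]}) (r : R)
    (D : hindex -> R[i] -> R[i]) (w : hindex) (n : nat) :
  (forall l, l \in L -> D w l = 0) -> amplitude L r D w n = 0.
Proof.
by move=> D0; rewrite /amplitude big_seq big1// => l /D0 ->; rewrite mul0r.
Qed.

Lemma real_complex_div (R : realType) (x y : R) : (x / y)%:C = x%:C / y%:C.
Proof. by rewrite rmorphM/= fmorphV. Qed.

Lemma hfunC_neq0 (R : realType) (w : hindex) :
  \forall n \near \oo, (hfun R w n)%:C != 0.
Proof.
near=> n; rewrite lt0r_neq0// ltcR.
by near: n; exact: hfun_gt0.
Unshelve. all: by end_near. Qed.

(** By induction on the number of indices up to [w]: when all earlier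
    coefficients are 0, the remainder at [w] is [b n - hfun w n * amplitude w n],
    and both it and [b n] are [o(hfun w n)], so the amplitude tends to 0. *)
Lemma expands_eq0 (R : realType) (b : nat -> R[i]) (T : {fset rat}) (e : nat)
    (L : {fset R[i]}) (r : R) (D : hindex -> R[i] -> R[i]) :
  common_magnitude L r -> expands b T e L r D ->
  (forall w, vanishing (fun n => b n / (hfun R w n)%:C)) ->
  forall w l, full_index_set T e w -> l \in L -> D w l = 0.
Proof.
move=> Lr bD b0 w.
have [k] := ubnP #|` fset_set (initial_segment T e w)|.
elim: k w => // k IHk w; rewrite ltnS => wk l wT lL.
have fin_w := finite_initial_segment T e.
have in_w : initial_segment T e w w by split=> //; rewrite /index_le eqxx.
have lower0 v : (initial_segment T e w `\ w) v ->
    forall x, x \in L -> D v x = 0.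
  move=> [[vT vw] /= /eqP nvw] x xL.
  have {nvw}vw : index_lt v w by move: vw; rewrite /index_le (negbTE nvw).
  apply: IHk => //; apply: leq_trans wk; apply: fproper_ltn_card.
  rewrite fproperE; apply/andP; split.
    apply/fsubsetP => u; rewrite !in_fset_set// !inE => -[uT uv]; split=> //.
    by rewrite /index_le (index_le_lt_trans uv vw) orbT.
  apply/fsubsetPn; exists w; rewrite in_fset_set//; first by rewrite inE.
  by apply/negP; rewrite inE => -[_]; apply/negP; rewrite -index_ltNge.
apply: (vanishing_amplitude Lr) => //.
apply: vanishing_near (vanishingD (b0 w) (vanishingN (bD w))).
near=> n; have hw : (hfun R w n)%:C != 0 by near: n; exact: hfunC_neq0.
rewrite (fsbigD1 w)//=.
have -> : \sum_(v \in initial_segment T e w `\ w)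
    (hfun R v n)%:C * amplitude L r D v n = 0.
  by apply: fsbig1 => v /lower0 v0; rewrite amplitude0 ?mulr0.
by field.
Unshelve. all: by end_near. Qed.

Lemma expandsB (R : realType) (b b' : nat -> R[i]) (T : {fset rat}) (e : nat)
    (L : {fset R[i]}) (r : R) (D D' : hindex -> R[i] -> R[i]) :
  expands b T e L r D -> expands b' T e L r D' ->
  expands (fun n => b n - b' n) T e L r (fun w l => D w l - D' w l).
Proof.
move=> bD bD' w; apply: vanishing_near (vanishingD (bD w) (vanishingN (bD' w))).
near=> n; rewrite -mulNr -mulrDl; congr (_ / _).
have fin_w := finite_initial_segment T e w.
rewrite !fsbig_finite//= opprD addrACA opprK; congr (_ + _).
apply: oppr_inj; rewrite opprD !opprK -sumrB; apply: eq_bigr => v _.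
rewrite -mulrBr; congr (_ * _); rewrite -sumrB; apply: eq_bigr => l _.
by rewrite mulrBl.
Unshelve. all: by end_near. Qed.

(** Up to [o(hfun w)], [b] is a finite sum of terms [hfun v * amplitude v] with
    bounded amplitudes, and a geometric factor makes each of them [o(hfun w)],
    even those with [v < w]. *)
Lemma expands_geometric (R : realType) (b : nat -> R[i]) (T : {fset rat})
    (e : nat) (L : {fset R[i]}) (r q : R) (D : hindex -> R[i] -> R[i]) :
  common_magnitude L r -> expands b T e L r D -> 0 < q < 1 ->
  forall w, vanishing (fun n => b n * q%:C ^+ n / (hfun R w n)%:C).
Proof.
move=> Lr bD q01 w; have /andP[q0 q1] := q01.
have qn (n : nat) : `|q%:C ^+ n| <= 1%:C.
  by rewrite normrX exprn_ile1// gtr0_norm ?ltcR// lecR ltW.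
have sum0 : vanishing (fun n => \sum_(v <- fset_set (initial_segment T e w))
    (hfun R v n / hfun R w n * q ^+ n)%:C * amplitude L r D v n).
  apply: vanishing_sum => v _; have [M ampM] := amplitude_bounded D v Lr.
  apply: vanishing_bounded ampM _; apply: vanishing_real.
  exact: hfun_ratio_geometric_cvg0.
apply: vanishing_near (vanishingD (vanishing_bounded qn (bD w)) sum0).
near=> n; have hw : (hfun R w n)%:C != 0 by near: n; exact: hfunC_neq0.
rewrite fsbig_finite/=; last exact: finite_initial_segment.
set sum_w := \sum_(v <- _) (hfun R v n)%:C * _.
have -> : \sum_(v <- fset_set (initial_segment T e w))
    (hfun R v n / hfun R w n * q ^+ n)%:C * amplitude L r D v n =
    sum_w * (q%:C ^+ n / (hfun R w n)%:C).
  rewrite mulr_suml; apply: eq_bigr => v _.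
  by rewrite rmorphM/= real_complex_div rmorphXn/=; field.
by field.
Unshelve. all: by end_near. Qed.

(** * Coefficients of an asymptotic expansion *)

(** The values of [c] outside [Omega * Lam] are arbitrary; erasing them makes
    the coefficients of an expansion a function that can be unique. *)
Definition total_coef (R : realType) (Omega : set hindex) (Lam : {fset R[i]})
    (c : hindex -> R[i] -> R[i]) (w : hindex) (l : R[i]) : R[i] :=
  if l \in Lam then extend0 Omega c w l else 0.

Lemma total_coefE (R : realType) (Omega : set hindex) (Lam : {fset R[i]})
    (c : hindex -> R[i] -> R[i]) (w : hindex) (l : R[i]) :
  Omega w -> l \in Lam -> total_coef Omega Lam c w l = c w l.
Proof. by rewrite /total_coef /extend0 => wO ->; rewrite mem_set. Qed.

Lemma total_coef_neq0 (R : realType) (Omega : set hindex) (Lam : {fset R[i]})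
    (c : hindex -> R[i] -> R[i]) (w : hindex) (l : R[i]) :
  total_coef Omega Lam c w l != 0 -> Omega w /\ l \in Lam.
Proof.
rewrite /total_coef /extend0; case: ifP => [lL|_]; last by rewrite eqxx.
by case: ifP => [/set_mem //|_]; rewrite eqxx.
Qed.

(** The given index [w] need not lie in the full index set of the expansion, so
    the remainder at [w] is compared with the one at a later index [u] of that
    set.  They differ by the terms at the finite set [V] of indices between [w]
    and [u]; after division by [hfun w] each of these tends to 0, and so does
    the remainder at [u], which is even [o(hfun u)]. *)
Lemma asymp_expansion_expands (R : realType) (a : nat -> R[i])
    (Omega : set hindex) (Lam : {fset R[i]}) (c : hindex -> R[i] -> R[i]) :
  asymp_expansion a Omega Lam c ->
  exists (S : {fset rat}) (d : nat) (r : R),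
  [/\ common_magnitude Lam r, Omega `<=` full_index_set S d,
      exists w l, total_coef Omega Lam c w l != 0 &
      forall (T : {fset rat}) (e : nat) (L : {fset R[i]}),
        (S `<=` T)%fset -> (d <= e)%N -> (Lam `<=` L)%fset ->
        expands (fun n => a n * r%:C ^- n) T e L r (total_coef Omega Lam c)].
Proof.
move=> [S [d [r [OS Lr [a_lim [w0 [l0 [w0S l0L c0]]]]]]]].
exists S, d, r; split=> //.
  by exists w0, l0; rewrite /total_coef l0L.
move=> T e L ST de LamL w; set D := total_coef Omega Lam c.
have full_sub := full_index_set_sub ST de.
have D0 v : ~ full_index_set S d v -> forall l, D v l = 0.
  move=> vS l; apply/eqP; apply: contraT => /total_coef_neq0[/OS].
  by move=> /vS.
have amp_eq v n : amplitude Lam r D v n =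
    \sum_(l <- Lam) extend0 Omega c v l * (l * r%:C^-1) ^+ n.
  rewrite /amplitude !big_seq; apply: eq_bigr => l lL.
  by rewrite /D /total_coef lL.
have amp_widen v n : amplitude L r D v n = amplitude Lam r D v n.
  rewrite (amplitude_widen r _ LamL)// => l lL.
  by rewrite /D /total_coef (negbTE lL).
have [u uS wu] := exists_index_gt w w0S.
pose V := initial_segment S d u `&` ~` initial_segment S d w.
have fin := finite_initial_segment S d.
have finV : finite_set V by exact: finite_setIl.
have V_gt v : V v -> index_lt w v.
  move=> [[vS vu] nvw]; rewrite index_ltNge; apply/negP => vw.
  by apply: nvw; split.
have lim_u : vanishing (fun n => remainder a S d Lam r (extend0 Omega c) u n /
    (hfun R u n)%:C * (hfun R u n / hfun R w n)%:C).
  rewrite /vanishing -[0 in X in _ --> X](mulr0 0).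
  apply: (@cvgM R[i]^o); first exact: a_lim.
  by apply: vanishing_real; exact: hfun_ratio_cvg0.
have lim_V : vanishing (fun n => \sum_(v <- fset_set V)
    (hfun R v n / hfun R w n)%:C * amplitude L r D v n).
  apply: vanishing_sum => v; rewrite in_fset_set// inE => /V_gt wv.
  have [M ampM] := amplitude_bounded D v Lr.
  have {}ampM n : `|amplitude L r D v n| <= M%:C by rewrite amp_widen.
  apply: vanishing_bounded ampM _; apply: vanishing_real.
  exact: hfun_ratio_cvg0.
apply: vanishing_near (vanishingD lim_u lim_V).
near=> n.
have hw : (hfun R w n)%:C != 0 by near: n; exact: hfunC_neq0.
have hu : (hfun R u n)%:C != 0 by near: n; exact: hfunC_neq0.
pose F v := (hfun R v n)%:C * amplitude L r D v n.
have -> : \sum_(v \in initial_segment T e w) F v =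
    \sum_(v \in initial_segment S d w) F v.
  apply/esym/fsbig_widen => [v [vS vw]|v [[_ vw] nvS]].
    by split=> //; exact: full_sub.
  rewrite /= /F amplitude0 ?mulr0// => l _; apply: D0 => vS.
  by apply: nvS; split.
have sum_u : \sum_(v \in initial_segment S d u) F v =
    \sum_(v \in initial_segment S d w) F v + \sum_(v <- fset_set V) F v.
  rewrite (fsbigID (initial_segment S d w))//= -/V (fsbig_finite _ _ finV)/=.
  congr (_ + _); apply: eq_fsbigl; apply/seteqP; split=> [v []//|v vw].
  split=> //; case: vw => vS vw; split=> //.
  by rewrite /index_le (index_le_lt_trans vw wu) orbT.
have -> : remainder a S d Lam r (extend0 Omega c) u n =
    a n * r%:C ^- n - \sum_(v \in initial_segment S d u) F v.
  rewrite /remainder; congr (_ - _); apply: eq_fsbigr => v _.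
  by rewrite /F amp_widen amp_eq.
have -> : \sum_(v <- fset_set V) (hfun R v n / hfun R w n)%:C *
    amplitude L r D v n = (\sum_(v <- fset_set V) F v) / (hfun R w n)%:C.
  rewrite mulr_suml; apply: eq_bigr => v _.
  by rewrite /F real_complex_div; field.
rewrite sum_u real_complex_div; set b := a n * _; field.
by apply/andP; split; [exact: hw|exact: hu].
Unshelve. all: by end_near. Qed.

Lemma expands_magnitude_le (R : realType) (a : nat -> R[i])
    (T T' : {fset rat}) (e e' : nat) (L L' : {fset R[i]}) (r r' : R)
    (D D' : hindex -> R[i] -> R[i]) :
  common_magnitude L r -> common_magnitude L' r' ->
  expands (fun n => a n * r%:C ^- n) T e L r D ->
  expands (fun n => a n * r'%:C ^- n) T' e' L' r' D' ->
  (exists w l, [/\ full_index_set T' e' w, l \in L' & D' w l != 0]) -> r' <= r.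
Proof.
move=> Lr Lr' aD aD' [w [l [wT lL]]]; apply: contraR; rewrite -ltNge => rr'.
apply/eqP; apply: (expands_eq0 Lr' aD') => // {w l wT lL} w.
have r0 : 0 < r by case: Lr.
have r'0 : 0 < r' by case: Lr'.
have q01 : 0 < r / r' < 1 by rewrite divr_gt0//= ltr_pdivrMr// mul1r.
apply: vanishing_near (expands_geometric Lr aD q01 w).
near=> n; congr (_ / _).
rewrite real_complex_div expr_div_n; field.
by rewrite !expf_neq0// lt0r_neq0// ltcR.
Unshelve. all: by end_near. Qed.

Lemma asymp_expansion_coef_unique (R : realType) (a : nat -> R[i])
    (Omega Omega' : set hindex) (Lam Lam' : {fset R[i]})
    (c c' : hindex -> R[i] -> R[i]) :
  asymp_expansion a Omega Lam c -> asymp_expansion a Omega' Lam' c' ->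
  forall w l, total_coef Omega Lam c w l = total_coef Omega' Lam' c' w l.
Proof.
move=> /asymp_expansion_expands[S [d [r [Lr OS [w0 [l0 c0]] aD]]]].
move=> /asymp_expansion_expands[S' [d' [r' [Lr' OS' [w0' [l0' c0']] aD']]]].
have rr' : r = r'.
  have aDs := aD _ _ _ (fsubset_refl S) (leqnn d) (fsubset_refl Lam).
  have aDs' := aD' _ _ _ (fsubset_refl S') (leqnn d') (fsubset_refl Lam').
  apply/le_anti/andP; split.
    apply: (expands_magnitude_le Lr' Lr aDs' aDs); exists w0, l0.
    by have [/OS] := total_coef_neq0 c0.
  apply: (expands_magnitude_le Lr Lr' aDs aDs'); exists w0', l0'.
  by have [/OS'] := total_coef_neq0 c0'.
subst r'.
pose T := (S `|` S')%fset; pose e := maxn d d'; pose L := (Lam `|` Lam')%fset.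
have LTr : common_magnitude L r.
  case: Lr => r0 Lr; split=> // l; rewrite in_fsetU => /orP[/Lr//|].
  by case: Lr' => _; apply.
have diff0 := expands_eq0 LTr (expandsB
  (aD T e L (fsubsetUl _ _) (leq_maxl _ _) (fsubsetUl _ _))
  (aD' T e L (fsubsetUr _ _) (leq_maxr _ _) (fsubsetUr _ _))).
have {}diff0 w l : full_index_set T e w -> l \in L ->
    total_coef Omega Lam c w l - total_coef Omega' Lam' c' w l = 0.
  apply: diff0 => v; apply: vanishing_near (@vanishing0 R).
  by near=> n; rewrite subrr mul0r.
move=> w l; apply/eqP; apply: contraT => neq.
have [wT lL] : full_index_set T e w /\ l \in L.
  have [/total_coef_neq0[/OS wS lL]|/negPn/eqP D0] :=
      boolP (total_coef Omega Lam c w l != 0).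
    split; last by rewrite in_fsetU lL.
    exact: full_index_set_sub (fsubsetUl _ _) (leq_maxl _ _) _ wS.
  have /total_coef_neq0[/OS' wS lL] : total_coef Omega' Lam' c' w l != 0.
    by rewrite eq_sym -D0.
  split; last by rewrite in_fsetU lL orbT.
  exact: full_index_set_sub (fsubsetUr _ _) (leq_maxr _ _) _ wS.
by rewrite -subr_eq0 diff0 ?eqxx in neq.
Unshelve. all: by end_near. Qed.

(** Minimality makes [Omega] and [Lam] recoverable from the coefficients. *)
Lemma minimal_support (R : realType) (Omega : set hindex) (Lam : {fset R[i]})
    (c : hindex -> R[i] -> R[i]) : minimal_expansion Omega Lam c ->
  (forall w, Omega w <-> exists l, total_coef Omega Lam c w l != 0) /\
  (forall l, l \in Lam <-> exists w, total_coef Omega Lam c w l != 0).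
Proof.
move=> [minL minO]; split=> [w|l]; split.
- by move=> wO; have [l lL cwl] := minO w wO; exists l; rewrite total_coefE.
- by move=> [l /total_coef_neq0[]].
- by move=> lL; have [w wO cwl] := minL l lL; exists w; rewrite total_coefE.
- by move=> [w /total_coef_neq0[]].
Qed.

Theorem proposition2p3 (R : realType) (a : nat -> R[i])
  (Omega Omega' : set hindex) (Lam Lam' : {fset R[i]})
  (c c' : hindex -> R[i] -> R[i])
  (a_exp : asymp_expansion a Omega Lam c) (c_min : minimal_expansion Omega Lam c)
  (a_exp' : asymp_expansion a Omega' Lam' c') (c_min' : minimal_expansion Omega' Lam' c') :
  [/\ Omega = Omega', Lam = Lam' &
      forall (w : hindex) (l : R[i]), Omega w -> l \in Lam -> c w l = c' w l].
Proof.
have coef_eq := asymp_expansion_coef_unique a_exp a_exp'.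
have [suppO suppL] := minimal_support c_min.
have [suppO' suppL'] := minimal_support c_min'.
have OO' : Omega = Omega'.
  apply/seteqP; split=> w.
    by move/suppO => [l cl]; apply/suppO'; exists l; rewrite -coef_eq.
  by move/suppO' => [l cl]; apply/suppO; exists l; rewrite coef_eq.
have LL' : Lam = Lam'.
  apply/fsetP => l; apply/idP/idP.
    by move/suppL => [w cw]; apply/suppL'; exists w; rewrite -coef_eq.
  by move/suppL' => [w cw]; apply/suppL; exists w; rewrite coef_eq.
split=> // w l wO lL.
by rewrite -(total_coefE c wO lL) coef_eq total_coefE -?OO' -?LL'.
Qed.
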